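(* Let $r\in\mathbb R$, $m>0$, $d>1$ and $0<p<1$. Let $\mu_0,\mu_1,\dots,\mu_\ell$ be the sequence of distributions obtained by applying a sequence of moves to an initial distribution $\mu_0$ with $\mu_0\{x>r\}=0$. If $\mu_{\max}\{x>r\}\le m$ and $\mu_{\max}\{x\ge r+d\}\ge pm$, then the sequence contains at least $\sqrt3\,p^{3/2}(d-\frac12)^3$ moves whose centers lie in $(r+\frac12,\infty)$.
   Context: A distribution is a finite set $\{(x_1,m_1),\dots,(x_k,m_k)\}$, $m_i>0$; $\mu(A)=\sum_{x_i\in A}m_i$; $M_j[\mu]=\sum_im_ix_i^j$. A move $v=([a,b],\delta)$ has $b-a=1$, $\delta$ a signed distribution on $[a,b]$ with $M_0[\delta]=M_1[\delta]=0$, and center $\frac{a+b}2$; it applies to $\mu$ if $\mu+\delta$ is a distribution, and $v\mu=\mu+\delta$. For a sequence of moves producing $\mu_i=v_i\mu_{i-1}$, $\mu_{\max}\{x>a\}=\max_{0\le i\le\ell}\mu_i\{x>a\}$ and $\mu_{\max}\{x\ge a\}=\max_{0\le i\le\ell}\mu_i\{x\ge a\}$. *)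

(* Defs.v *)
From Stdlib Require Import Reals Lra List.
Import ListNotations.
Open Scope R_scope.

(* A (signed) distribution is a finite list of (point, mass) pairs;
   repeated points are allowed and their masses add up. *)
Definition sdist := list (R * R).

Definition mass_gt (mu : sdist) (a : R) : R :=
  fold_right (fun p acc => (if Rlt_dec a (fst p) then snd p else 0) + acc) 0 mu.

Definition mass_ge (mu : sdist) (a : R) : R :=
  fold_right (fun p acc => (if Rle_dec a (fst p) then snd p else 0) + acc) 0 mu.

Definition mass_at (mu : sdist) (x : R) : R :=
  fold_right (fun p acc => (if Req_EM_T (fst p) x then snd p else 0) + acc) 0 mu.

Definition moment (j : nat) (mu : sdist) : R :=
  fold_right (fun p acc => snd p * fst p ^ j + acc) 0 mu.

(* A signed distribution is a (nonnegative) distribution iff the total mass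
   at every point is nonnegative (points of total mass 0 are dropped). *)
Definition is_distribution (mu : sdist) : Prop :=
  forall x, 0 <= mass_at mu x.

Record move := Move { mv_a : R ; mv_delta : sdist }.

Definition valid_move (v : move) : Prop :=
  Forall (fun p => mv_a v <= fst p <= mv_a v + 1) (mv_delta v) /\
  moment 0 (mv_delta v) = 0 /\ moment 1 (mv_delta v) = 0.

Definition center (v : move) : R := mv_a v + 1 / 2.

(* mu_i : the distribution after applying the first i moves of vs to mu0
   (mu + delta represented by concatenation). *)
Definition mu_at (mu0 : sdist) (vs : list move) (i : nat) : sdist :=
  mu0 ++ concat (map mv_delta (firstn i vs)).

Definition count_center_gt (vs : list move) (c : R) : nat :=
  length (filter (fun v => if Rlt_dec c (center v) then true else false) vs).

(* Main.v *)
Require Import Defs.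
From Stdlib Require Import Reals List.
From Stdlib Require Import Lra Lia Psatz.
Open Scope R_scope.

(** Normalise r = 0, m = 1.  A distribution is encoded by its excess function
    F(t) = sum m_i (x_i - t)^+, which is convex; a move on [a, a+1] changes F only
    there and cannot raise it above its chord.  Moves with a <= 0 do not affect F on
    [1, oo), and F has slope >= -1 on [0, 1].  Hence F is dominated on [1, oo) by a
    function G that starts at 0, is replaced by its chord at every counted move, and
    is extended to [0, 1] with slope -1.  Let q = -G', regarded as the tail of a
    probability on [1, oo) and symmetrised about 1/2; let X be its second moment about
    1/2 and S its spread (mean half-difference of two independent copies).  By
    Cauchy-Schwarz every counted move increases S by at least (increase of X)^2, while
    S <= sqrt (X / 3) always and X >= p (d - 1/2)^2 =: X' at the end.  Together these
    bound the number n of counted moves by n >= sqrt 3 X'^(3/2), except that the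
    initial values X = S = 1/4 spoil the estimate for small X', where n = 1 and n = 2
    are treated separately.

    All breakpoints of G lie on a grid fixed in advance, so q is a sequence of cell
    values and all integrals are finite sums. *)

(** * Finite sums over index ranges *)

Fixpoint psum (f : nat -> R) (n : nat) : R :=
  match n with O => 0 | S k => psum f k + f k end.

Definition dsum (f : nat -> R) (i j : nat) : R := psum f j - psum f i.

Lemma dsum_chasles f i j k : dsum f i j + dsum f j k = dsum f i k.
Proof. unfold dsum; ring. Qed.

Lemma dsum_refl f i : dsum f i i = 0.
Proof. unfold dsum; ring. Qed.

Lemma dsum_eq0 f i j : (forall k, f k = 0) -> dsum f i j = 0.
Proof.
intros h; assert (H : forall n, psum f n = 0)
  by (induction n as [|n IH]; simpl; [|rewrite IH, h]; ring).
unfold dsum; rewrite !H; ring.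
Qed.

Lemma dsum_S f i j : dsum f i (S j) = dsum f i j + f j.
Proof. unfold dsum; simpl; ring. Qed.

Lemma dsum_le f g i j : (i <= j)%nat ->
  (forall k, (i <= k < j)%nat -> f k <= g k) -> dsum f i j <= dsum g i j.
Proof.
intros hij; induction hij as [|j hij IH]; intros h.
- rewrite !dsum_refl; lra.
- rewrite !dsum_S; apply Rplus_le_compat; [apply IH; intros k hk|]; apply h; lia.
Qed.

Lemma dsum_ext f g i j : (i <= j)%nat ->
  (forall k, (i <= k < j)%nat -> f k = g k) -> dsum f i j = dsum g i j.
Proof.
intros hij h; apply Rle_antisym; apply dsum_le; trivial; intros k hk;
  rewrite h by trivial; lra.
Qed.

Lemma dsum_plus f g i j :
  dsum (fun k => f k + g k) i j = dsum f i j + dsum g i j.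
Proof.
assert (H : forall n, psum (fun k => f k + g k) n = psum f n + psum g n)
  by (induction n as [|n IH]; simpl; [|rewrite IH]; ring).
unfold dsum; rewrite !H; ring.
Qed.

Lemma dsum_scal c f i j : dsum (fun k => c * f k) i j = c * dsum f i j.
Proof.
assert (H : forall n, psum (fun k => c * f k) n = c * psum f n)
  by (induction n as [|n IH]; simpl; [|rewrite IH]; ring).
unfold dsum; rewrite !H; ring.
Qed.

Lemma dsum_telescope (f : nat -> R) i j :
  dsum (fun k => f (S k) - f k) i j = f j - f i.
Proof.
assert (H : forall n, psum (fun k => f (S k) - f k) n = f n - f O)
  by (induction n as [|n IH]; simpl; [|rewrite IH]; ring).
unfold dsum; rewrite !H; ring.
Qed.

(** * Step functions on a grid *)

Definition len (t : nat -> R) (k : nat) : R := t (S k) - t k.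
Definition mid (t : nat -> R) (k : nat) : R := (t k + t (S k)) / 2.

Definition monotone_upto (t : nat -> R) (n : nat) : Prop :=
  forall k, (k < n)%nat -> t k <= t (S k).

Lemma monotone_upto_le t n i j :
  monotone_upto t n -> (i <= j <= n)%nat -> t i <= t j.
Proof.
intros ht [hij hjn]; induction hij as [|j hij IH]; [lra|].
specialize (ht j ltac:(lia)); specialize (IH ltac:(lia)); lra.
Qed.

Lemma dsum_len t i j : dsum (len t) i j = t j - t i.
Proof. exact (dsum_telescope t i j). Qed.

Lemma dsum_len_mid t i j : (i <= j)%nat ->
  dsum (fun k => len t k * mid t k) i j = (t j ^ 2 - t i ^ 2) / 2.
Proof.
intros hij.
rewrite (dsum_ext _ (fun k => t (S k) ^ 2 / 2 - t k ^ 2 / 2)) by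
  (trivial; intros k _; unfold len, mid; field).
rewrite (dsum_telescope (fun k => t k ^ 2 / 2)); field.
Qed.

(** The midpoint rule underestimates the integral of a convex function; for this square each cell
    loses exactly [len t k ^ 3 / 12]. *)
Lemma dsum_len_mid_sqr t B i j n : monotone_upto t n -> (i <= j <= n)%nat ->
  dsum (fun k => len t k * (mid t k - B) ^ 2) i j
    <= ((t j - B) ^ 3 - (t i - B) ^ 3) / 3.
Proof.
intros ht hij.
apply Rle_trans with
  (dsum (fun k => (t (S k) - B) ^ 3 / 3 - (t k - B) ^ 3 / 3) i j).
- apply dsum_le; [lia|intros k hk].
  assert (h : t k <= t (S k)) by (apply ht; lia).
  unfold len, mid.
  assert (0 <= (t (S k) - t k) ^ 3) by (apply pow_le; lra).
  nra.
- rewrite (dsum_telescope (fun k => (t k - B) ^ 3 / 3)); lra.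
Qed.

Lemma dsum_len_mul_nonneg t q i j n :
  monotone_upto t n -> (forall k, 0 <= q k) -> (i <= j <= n)%nat ->
  0 <= dsum (fun k => len t k * q k) i j.
Proof.
intros ht hq hij.
rewrite <- (dsum_eq0 (fun _ => 0) i j) by reflexivity.
apply dsum_le; [lia|intros k hk].
assert (t k <= t (S k)) by (apply ht; lia).
apply Rmult_le_pos; [unfold len; lra|apply hq].
Qed.

(* Cauchy-Schwarz against the affine functions on [t i, t j]. *)
Lemma sum_sqr_ge_affine_part t q i j n :
  monotone_upto t n -> (i <= j <= n)%nat -> t i < t j ->
  let L := t j - t i in
  let Q0 := dsum (fun k => len t k * q k) i j in
  let E := dsum (fun k => len t k * mid t k * q k) i j - (t i + t j) / 2 * Q0 in
  Q0 ^ 2 / L + 12 * E ^ 2 / L ^ 3 <= dsum (fun k => len t k * q k ^ 2) i j.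
Proof.
intros ht hij hlt L Q0 E.
set (Q2 := dsum _ _ _).
set (B := (t i + t j) / 2) in *.
assert (hL : 0 < L) by (unfold L; lra).
(* The mean square distance of [q] from the affine function [u + v * (x - B)], expanded;
   [L ^ 3 / 12] bounds the discrete second moment about the centre [B]. *)
assert (key : forall u v, 0 <= Q2 - 2 * u * Q0 - 2 * v * E + u ^ 2 * L + v ^ 2 * (L ^ 3 / 12)).
{ intros u v.
  assert (h0 : 0 <= dsum (fun k => len t k * (q k - u - v * (mid t k - B)) ^ 2) i j).
  { apply (dsum_len_mul_nonneg t _ i j n ht); [intros; apply pow2_ge_0|trivial]. }
  rewrite (dsum_ext _ (fun k =>
     len t k * q k ^ 2 + ((-2 * u + 2 * v * B) * (len t k * q k)
     + (- 2 * v * (len t k * mid t k * q k)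
     + ((u ^ 2 - 2 * u * v * B) * len t k + (2 * u * v * (len t k * mid t k)
     + v ^ 2 * (len t k * (mid t k - B) ^ 2))))))) in h0
    by (try lia; intros; ring).
  rewrite !dsum_plus, !dsum_scal, dsum_len_mid, dsum_len in h0 by lia.
  pose proof (dsum_len_mid_sqr t B i j n ht hij) as h1.
  apply (Rmult_le_compat_l (v ^ 2)) in h1; [|apply pow2_ge_0].
  fold Q2 Q0 in h0. fold L in h0.
  replace (((t j - B) ^ 3 - (t i - B) ^ 3) / 3) with (L ^ 3 / 12) in h1
    by (unfold L, B; field).
  replace ((t j ^ 2 - t i ^ 2) / 2) with (B * L) in h0 by (unfold L, B; field).
  unfold E; fold B; nra. }
(* The minimiser of the quadratic in [u] and [v]. *)
specialize (key (Q0 / L) (12 * E / L ^ 3)).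
replace (Q0 ^ 2 / L + 12 * E ^ 2 / L ^ 3) with
  (2 * (Q0 / L) * Q0 + 2 * (12 * E / L ^ 3) * E - (Q0 / L) ^ 2 * L
   - (12 * E / L ^ 3) ^ 2 * (L ^ 3 / 12)) by (field; lra).
lra.
Qed.

(** Replacing the dominating function by a segment over [[t i, t j]] makes its slope constant there,
    so the cells [i], ..., [j - 1] of [q] receive a common value. *)
Definition set_range (i j : nat) (c : R) (q : nat -> R) (k : nat) : R :=
  if andb (Nat.leb i k) (Nat.ltb k j) then c else q k.

Lemma set_range_in i j c q k : (i <= k < j)%nat -> set_range i j c q k = c.
Proof.
intros [h1 h2]; unfold set_range.
apply Nat.leb_le in h1; apply Nat.ltb_lt in h2; rewrite h1, h2; reflexivity.
Qed.

Lemma set_range_out i j c q k : (k < i \/ j <= k)%nat -> set_range i j c q k = q k.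
Proof.
intros h; unfold set_range.
destruct (Nat.leb_spec i k), (Nat.ltb_spec k j); simpl; trivial; lia.
Qed.

Lemma set_range_nonneg i j c q :
  0 <= c -> (forall k, 0 <= q k) -> forall k, 0 <= set_range i j c q k.
Proof. intros hc hq k; unfold set_range; destruct andb; auto. Qed.

Lemma dsum_set_range (g : nat -> R -> R) i j n c q : (i <= j <= n)%nat ->
  dsum (fun k => g k (set_range i j c q k)) 0 n =
  dsum (fun k => g k (q k)) 0 n
  + (dsum (fun k => g k c) i j - dsum (fun k => g k (q k)) i j).
Proof.
intros hij.
rewrite <- (dsum_chasles _ 0 i n), <- (dsum_chasles _ i j n).
rewrite <- (dsum_chasles (fun k => g k (q k)) 0 i n),
  <- (dsum_chasles (fun k => g k (q k)) i j n).
rewrite (dsum_ext _ (fun k => g k (q k)) 0 i) by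
  (try lia; intros; rewrite set_range_out by lia; reflexivity).
rewrite (dsum_ext _ (fun k => g k (q k)) j n) by
  (try lia; intros; rewrite set_range_out by lia; reflexivity).
rewrite (dsum_ext _ (fun k => g k c) i j) by
  (try lia; intros; rewrite set_range_in by lia; reflexivity).
ring.
Qed.

(* For the tail [q] of a distribution on [1, oo), symmetrised about 1/2, the
   second moment about 1/2 is [1/4 + second_gain] and the spread is
   [1/4 + spread_gain]; both gains vanish when all the mass sits at 1. *)
Definition second_gain (t : nat -> R) (n : nat) (q : nat -> R) : R :=
  2 * dsum (fun k => len t k * (mid t k - 1 / 2) * q k) 0 n.

Definition spread_gain (t : nat -> R) (n : nat) (q : nat -> R) : R :=
  dsum (fun k => len t k * (q k - q k ^ 2 / 2)) 0 n.

(** The dominating function G at [t k], recovered from [q] = -G' with G = 0 at [t n]. *)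
Definition tail_integral (t : nat -> R) (n : nat) (q : nat -> R) (k : nat) : R :=
  dsum (fun k => len t k * q k) k n.

Lemma tail_integral_nonneg t n q k : monotone_upto t n ->
  (forall k, 0 <= q k) -> (k <= n)%nat -> 0 <= tail_integral t n q k.
Proof.
intros ht hq hk; apply (dsum_len_mul_nonneg t q k n n); trivial; lia.
Qed.

Lemma second_gain_set_range t n q i j c : (i <= j <= n)%nat ->
  second_gain t n (set_range i j c q) - second_gain t n q =
  2 * (c * ((t j ^ 2 - t i ^ 2) / 2 - (t j - t i) / 2)
   - (dsum (fun k => len t k * mid t k * q k) i j
      - 1 / 2 * dsum (fun k => len t k * q k) i j)).
Proof.
intros hij; unfold second_gain.
rewrite (dsum_set_range (fun k x => len t k * (mid t k - 1 / 2) * x)) by trivial.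
rewrite (dsum_ext (fun k => _ * c) (fun k => c * (len t k * mid t k) + (- c / 2) * len t k) i j)
  by (try lia; intros; field).
rewrite (dsum_ext (fun k => _ * q k)
   (fun k => len t k * mid t k * q k + (- (1 / 2)) * (len t k * q k)) i j)
  by (try lia; intros; field).
rewrite !dsum_plus, !dsum_scal, dsum_len, dsum_len_mid by lia.
field.
Qed.

Lemma spread_gain_set_range t n q i j c : (i <= j <= n)%nat ->
  spread_gain t n (set_range i j c q) - spread_gain t n q =
  (c - c ^ 2 / 2) * (t j - t i) - dsum (fun k => len t k * q k) i j
  + 1 / 2 * dsum (fun k => len t k * q k ^ 2) i j.
Proof.
intros hij; unfold spread_gain.
rewrite (dsum_set_range (fun k x => len t k * (x - x ^ 2 / 2))) by trivial.
rewrite (dsum_ext (fun k => _ * (c - _)) (fun k => (c - c ^ 2 / 2) * len t k) i j)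
  by (try lia; intros; field).
rewrite (dsum_ext (fun k => _ * (q k - _))
   (fun k => len t k * q k + (- (1 / 2)) * (len t k * q k ^ 2)) i j)
  by (try lia; intros; field).
rewrite !dsum_plus, !dsum_scal, dsum_len by lia.
field.
Qed.

(** On a unit interval the integral of [q] is also its mean. With [E] the first moment of [q] about
    the centre, the second moment changes by [- 2 * E], while the spread grows by half the variance
    of [q], which is at least [6 * E ^ 2]. *)
Lemma spread_gain_flatten t n q i j :
  monotone_upto t n -> (i <= j <= n)%nat -> t j = t i + 1 ->
  let q' := set_range i j (dsum (fun k => len t k * q k) i j) q in
  (second_gain t n q' - second_gain t n q) ^ 2
    <= spread_gain t n q' - spread_gain t n q.
Proof.
intros ht hij htj q'; unfold q'.
rewrite second_gain_set_range, spread_gain_set_range by trivial.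
pose proof (sum_sqr_ge_affine_part t q i j n ht hij ltac:(lra)) as H.
cbv zeta in H.
set (Q0 := dsum (fun k => len t k * q k) i j) in *.
set (Q1 := dsum (fun k => len t k * mid t k * q k) i j) in *.
set (Q2 := dsum (fun k => len t k * q k ^ 2) i j) in *.
rewrite htj in *.
replace (t i + 1 - t i) with 1 in * by ring.
replace ((t i + 1) ^ 2 - t i ^ 2) with (2 * t i + 1) by ring.
set (E := Q1 - (t i + (t i + 1)) / 2 * Q0) in *.
replace (2 * (Q0 * ((2 * t i + 1) / 2 - 1 / 2) - (Q1 - 1 / 2 * Q0))) with (- 2 * E)
  by (unfold E; field).
pose proof (pow2_ge_0 E).
replace (12 * E ^ 2 / 1 ^ 3) with (12 * E ^ 2) in H by field.
lra.
Qed.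

Lemma refill_quadratic_bound (a W E : R) : 0 < a < 1 ->
  4 * ((1 - a ^ 2) * W / 2 - E) ^ 2
    <= 1 / 2 * (W ^ 2 / a + 12 * E ^ 2 / a ^ 3 - a * W ^ 2).
Proof.
intros ha.
set (e := E / a ^ 2); set (b := 1 - a ^ 2).
assert (hE : E = a ^ 2 * e) by (unfold e; field; lra).
assert (hb : 0 <= b) by (unfold b; nra).
replace (W ^ 2 / a + 12 * E ^ 2 / a ^ 3 - a * W ^ 2)
  with ((b * W ^ 2 + 12 * a ^ 2 * e ^ 2) / a) by (rewrite hE; unfold b; field; lra).
rewrite hE.
set (T := b * W ^ 2 + 12 * a ^ 2 * e ^ 2).
assert (hT : 0 <= T).
{ unfold T; pose proof (pow2_ge_0 W); pose proof (pow2_ge_0 (a * e)); nra. }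
(* Cauchy-Schwarz with the weights of [T]; the difference of the two sides is exactly the square in
   [h]. *)
assert (CS : (b * W / 2 - a ^ 2 * e) ^ 2 <= T * (a ^ 2 / 12 + b / 4)).
{ unfold T.
  assert (h : 0 <= b * (a * W / 6 + a * e) ^ 2 * 3).
  { pose proof (pow2_ge_0 (a * W / 6 + a * e)); nra. }
  lra. }
assert (hk : a * (a ^ 2 / 12 + b / 4) <= 1 / 8).
(* The left side is [a / 4 - a ^ 3 / 6], maximal at [a] = 1/sqrt 2, close to 7/10; the product is a
   cubic nearly tangent there. *)
{ assert (0 <= (a - 7 / 10) ^ 2 * (a + 14 / 10))
    by (apply Rmult_le_pos; [apply pow2_ge_0|lra]).
  unfold b; lra. }
apply Rmult_le_reg_l with a; [lra|].
replace (a * (1 / 2 * (T / a))) with (T / 2) by (field; lra).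
apply Rle_trans with (4 * (T * (a * (a ^ 2 / 12 + b / 4)))); nra.
Qed.

(** A move on [[a, 1 + a]] straddles 1. The new value is minus the slope of the chord starting on
    the slope -1 extension, at height [1 - a] above G(1). The claim reduces to
    [refill_quadratic_bound] with [W] the integral of [1 - q] over [[1, 1 + a]]. *)
Lemma spread_gain_refill t n q j a :
  monotone_upto t n -> (j <= n)%nat -> t O = 1 -> 0 < a < 1 -> t j = 1 + a ->
  let q' := set_range 0 j (1 - a + dsum (fun k => len t k * q k) 0 j) q in
  (second_gain t n q' - second_gain t n q) ^ 2
    <= spread_gain t n q' - spread_gain t n q.
Proof.
intros ht hj ht0 ha htj q'; unfold q'.
rewrite second_gain_set_range, spread_gain_set_range by lia.
pose proof (sum_sqr_ge_affine_part t q 0 j n ht ltac:(lia) ltac:(lra)) as H.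
cbv zeta in H.
set (Q0 := dsum (fun k => len t k * q k) 0 j) in *.
set (Q1 := dsum (fun k => len t k * mid t k * q k) 0 j) in *.
set (Q2 := dsum (fun k => len t k * q k ^ 2) 0 j) in *.
rewrite htj, ht0 in *.
replace (1 + a - 1) with a in * by ring.
set (E := Q1 - (1 + (1 + a)) / 2 * Q0) in *.
pose proof (refill_quadratic_bound a (a - Q0) E ha) as H2.
replace ((a - Q0) ^ 2 / a) with (a - 2 * Q0 + Q0 ^ 2 / a) in H2 by (field; lra).
match goal with |- ?x ^ 2 <= _ =>
  replace (x ^ 2) with (4 * ((1 - a ^ 2) * (a - Q0) / 2 - E) ^ 2)
  by (unfold E; field) end.
set (Z := 4 * _ ^ 2) in *; set (Y := 12 * E ^ 2 / a ^ 3) in *.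
nra.
Qed.

(** Midpoint rule for the convex function [3 * Rmax 0 x ^ 2] on [[v, u]]. *)
Lemma midpoint_cube_bound u v : v <= u ->
  3 * (u - v) * Rmax 0 ((u + v) / 2) ^ 2 <= Rmax 0 u ^ 3 - Rmax 0 v ^ 3.
Proof.
intros huv.
destruct (Rle_lt_dec 0 v) as [hv|hv].
- rewrite !Rmax_right by lra.
  assert (0 <= (u - v) ^ 3) by (apply pow_le; lra); lra.
- rewrite (Rmax_left 0 v) by lra.
  destruct (Rle_lt_dec 0 (u + v)) as [huv'|huv'].
  + rewrite !Rmax_right by lra.
    assert (0 <= (- v) * (u + v) * (u + (u + v))).
    { repeat apply Rmult_le_pos; lra. }
    assert (0 <= u ^ 3 /\ 0 <= (- v) ^ 3) by (split; apply pow_le; lra).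
    nra.
  + rewrite (Rmax_left 0 ((u + v) / 2)) by lra.
    assert (0 <= Rmax 0 u ^ 3) by apply pow_le, Rmax_l; lra.
Qed.

(** Lagrangian form of the bound of the spread by sqrt (X / 3), with multiplier [th]: at each point
    x, [q - q ^ 2 / 2 - th * (x - 1 / 2) * q] is maximised separately over [q >= 0]. *)
Lemma spread_gain_le t n q th :
  monotone_upto t n -> t O = 1 -> (forall k, 0 <= q k) -> 0 < th <= 2 ->
  spread_gain t n q <= th / 2 * second_gain t n q + (1 - th / 2) ^ 3 / (6 * th).
Proof.
intros ht ht0 hq hth.
(* The integral over [[x, oo)] of the pointwise maximum, half the squared positive part of
   [1 - th * (y - 1 / 2)]. *)
set (psi := fun x => Rmax 0 (1 - th * (x - 1 / 2)) ^ 3 / (6 * th)).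
assert (hsum : dsum (fun k => len t k * (q k - q k ^ 2 / 2)
   + (- th) * (len t k * (mid t k - 1 / 2) * q k)) 0 n
   <= dsum (fun k => (- psi (t (S k))) - (- psi (t k))) 0 n).
{ apply dsum_le; [lia|intros k hk].
  assert (h : t k <= t (S k)) by (apply ht; lia).
  specialize (hq k).
  pose proof (midpoint_cube_bound (1 - th * (t k - 1 / 2)) (1 - th * (t (S k) - 1 / 2))
    ltac:(nra)) as hc.
  set (z := (_ + _) / 2) in hc.
  apply Rle_trans with (len t k * (Rmax 0 z ^ 2 / 2)).
  - replace (len t k * (q k - q k ^ 2 / 2) + - th * (len t k * (mid t k - 1 / 2) * q k))
      with (len t k * (q k * z - q k ^ 2 / 2)) by (unfold z, mid; field).
    apply Rmult_le_compat_l; [unfold len; lra|].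
    pose proof (pow2_ge_0 (q k - z)); pose proof (pow2_ge_0 (q k)).
    unfold Rmax; destruct Rle_dec; [lra|].
    assert (0 <= q k * (- z)) by (apply Rmult_le_pos; lra); lra.
  - apply Rmult_le_reg_l with (6 * th); [lra|].
    unfold psi.
    replace (6 * th * (- (Rmax 0 (1 - th * (t (S k) - 1 / 2)) ^ 3 / (6 * th)) -
      - (Rmax 0 (1 - th * (t k - 1 / 2)) ^ 3 / (6 * th)))) with
     (Rmax 0 (1 - th * (t k - 1 / 2)) ^ 3 - Rmax 0 (1 - th * (t (S k) - 1 / 2)) ^ 3)
     by (field; lra).
    unfold len; nra. }
rewrite dsum_plus, dsum_scal, (dsum_telescope (fun k => - psi (t k))) in hsum.
assert (h0 : psi (t O) = (1 - th / 2) ^ 3 / (6 * th)).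
{ unfold psi; rewrite ht0, Rmax_right by lra; f_equal; f_equal; field. }
assert (h1 : 0 <= psi (t n)).
{ unfold psi; apply Rmult_le_pos; [apply pow_le, Rmax_l|].
  left; apply Rinv_0_lt_compat; lra. }
unfold spread_gain, second_gain; lra.
Qed.

(** The second moment is monotone in G, and the bound equals [p * d * (d - 1)], the gain when mass
    [p] sits at [d] and the rest at 1. *)
Lemma second_gain_ge t n q p d :
  monotone_upto t n -> t O = 1 -> 0 <= p -> 1 <= d <= t n ->
  (forall k, (k <= n)%nat -> p * Rmax 0 (d - t k) <= tail_integral t n q k) ->
  p * (d - 1) ^ 2 + p * (d - 1) <= second_gain t n q.
Proof.
intros ht ht0 hp hd hG.
set (G := tail_integral t n q) in *.
(* Summation by parts against the trapezoidal sums of [G]. *)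
assert (parts : forall k, (k <= n)%nat ->
  p * (Rmax 0 (d - 1) ^ 2 - Rmax 0 (d - t k) ^ 2) / 2
  <= dsum (fun k => len t k * (mid t k - 1) * q k) 0 k + G k * (t k - 1)).
{ induction k as [|k IH]; intros hk.
  - rewrite dsum_refl, ht0; lra.
  - specialize (IH ltac:(lia)).
    rewrite dsum_S.
    assert (h : t k <= t (S k)) by (apply ht; lia).
    assert (hGk : G k = len t k * q k + G (S k)).
    { unfold G, tail_integral.
      rewrite <- (dsum_chasles _ k (S k) n), (dsum_S _ k k), dsum_refl; ring. }
    pose proof (hG k ltac:(lia)) as g1; pose proof (hG (S k) hk) as g2.
    (* Trapezoids overestimate the integral of the convex function [p * Rmax 0 (d - x)], so [d] may
       fall inside a cell. *)
    assert (tr : p * (Rmax 0 (d - t k) ^ 2 - Rmax 0 (d - t (S k)) ^ 2) / 2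
       <= len t k * (G k + G (S k)) / 2).
    { apply Rle_trans with
        (len t k * (p * Rmax 0 (d - t k) + p * Rmax 0 (d - t (S k))) / 2).
      - assert (hm : Rmax 0 (d - t k) - Rmax 0 (d - t (S k)) <= len t k)
          by (unfold len, Rmax; repeat destruct Rle_dec; lra).
        pose proof (Rmax_l 0 (d - t k)); pose proof (Rmax_l 0 (d - t (S k))).
        assert (0 <= p * (Rmax 0 (d - t k) + Rmax 0 (d - t (S k))))
          by (apply Rmult_le_pos; lra).
        nra.
      - assert (0 <= len t k) by (unfold len; lra). nra. }
    unfold len, mid in *; nra. }
specialize (parts n ltac:(lia)).
assert (hGn : G n = 0) by apply dsum_refl.
rewrite hGn, (Rmax_right 0 (d - 1)), (Rmax_left 0 (d - t n)) in parts by lra.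
pose proof (hG O ltac:(lia)) as g0.
rewrite ht0, Rmax_right in g0 by lra.
unfold second_gain.
rewrite (dsum_ext (fun k => _ * (_ - 1 / 2) * _)
  (fun k => len t k * (mid t k - 1) * q k + 1 / 2 * (len t k * q k)))
  by (try lia; intros; field).
rewrite dsum_plus, dsum_scal.
unfold G, tail_integral in g0; lra.
Qed.

(** * Grids through prescribed points *)

Lemma monotone_upto_insert t n x : monotone_upto t n -> t O <= x ->
  exists t', monotone_upto t' (S n) /\ t' O = t O /\
    (exists k, (k <= S n)%nat /\ t' k = x) /\
    (forall i, (i <= n)%nat -> exists k, (k <= S n)%nat /\ t' k = t i).
Proof.
intros ht hx.
assert (hk : exists k, (k <= n)%nat /\ t k <= x /\ ((k < n)%nat -> x <= t (S k))).
{ clear ht; induction n as [|n [k [h1 [h2 h3]]]]; [exists O; repeat split; trivial; lia|].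
  destruct (Nat.eq_dec k n) as [->|hkn].
  - destruct (Rle_lt_dec (t (S n)) x) as [h|h].
    + exists (S n); repeat split; trivial; lia.
    + exists n; repeat split; trivial; [lia|intros; lra].
  - exists k; repeat split; trivial; [lia|intros; apply h3; lia]. }
destruct hk as [k [h1 [h2 h3]]].
exists (fun i => if Nat.leb i k then t i else if Nat.eqb i (S k) then x else t (pred i)).
split; [|split; [|split]].
- intros i hi.
  destruct (Nat.leb_spec (S i) k), (Nat.leb_spec i k), (Nat.eqb_spec (S i) (S k)),
    (Nat.eqb_spec i (S k)); try lia; subst; simpl; trivial.
  + apply ht; lia.
  + replace i with k by lia; trivial.
  + apply h3; lia.
  + destruct i as [|i]; [lia|]; simpl; apply ht; lia.
- reflexivity.
- exists (S k); split; [lia|].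
  destruct (Nat.leb_spec (S k) k); [lia|]; rewrite Nat.eqb_refl; reflexivity.
- intros i hi; destruct (Nat.leb_spec i k) as [h|h].
  + exists i; split; [lia|]; apply Nat.leb_le in h; rewrite h; reflexivity.
  + exists (S i); split; [lia|].
    destruct (Nat.leb_spec (S i) k), (Nat.eqb_spec (S i) (S k)); try lia; reflexivity.
Qed.

Lemma grid_exists (x0 : R) (l : list R) : exists t n,
  monotone_upto t n /\ t O = x0 /\
  forall x, In x l -> x0 <= x -> exists k, (k <= n)%nat /\ t k = x.
Proof.
induction l as [|y l [t [n [h1 [h2 h3]]]]].
- exists (fun _ => x0), O; repeat split; [intros k hk; lia|intros x []].
- destruct (Rle_lt_dec x0 y) as [hy|hy].
  + destruct (monotone_upto_insert t n y h1 ltac:(lra)) as [t' [g1 [g2 [g3 g4]]]].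
    exists t', (S n); repeat split; trivial; [lra|].
    intros x [->|hx] hx0; trivial.
    destruct (h3 x hx hx0) as [i [hi <-]]; auto.
  + exists t, n; repeat split; trivial.
    intros x [->|hx] hx0; [lra|auto].
Qed.

(** * Distributions and their excess functions *)

(** The integral of [f]; masses, moments and excess are all instances, so inequalities between them
    reduce to pointwise ones. *)
Definition lin (f : R -> R) (mu : sdist) : R :=
  fold_right (fun p acc => snd p * f (fst p) + acc) 0 mu.

Lemma lin_app f mu nu : lin f (mu ++ nu) = lin f mu + lin f nu.
Proof. induction mu as [|p mu IH]; simpl; [|rewrite IH]; ring. Qed.

Lemma lin_ext f g mu : (forall p, In p mu -> f (fst p) = g (fst p)) -> lin f mu = lin g mu.
Proof.
induction mu as [|p mu IH]; simpl; intros h; trivial.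
rewrite h, IH by auto; reflexivity.
Qed.

Lemma lin_plus f g mu : lin (fun x => f x + g x) mu = lin f mu + lin g mu.
Proof. induction mu as [|p mu IH]; simpl; [|rewrite IH]; ring. Qed.

Lemma lin_scal c f mu : lin (fun x => c * f x) mu = c * lin f mu.
Proof. induction mu as [|p mu IH]; simpl; [|rewrite IH]; ring. Qed.

Definition remove_point (x : R) (mu : sdist) : sdist :=
  filter (fun p => if Req_EM_T (fst p) x then false else true) mu.

Lemma lin_remove_point f x mu : lin f mu = mass_at mu x * f x + lin f (remove_point x mu).
Proof.
induction mu as [|p mu IH]; simpl; [ring|].
rewrite IH; destruct Req_EM_T as [e|e]; simpl; [rewrite e|]; ring.
Qed.

Lemma mass_at_remove_point x y mu :
  mass_at (remove_point x mu) y = if Req_EM_T y x then 0 else mass_at mu y.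
Proof.
induction mu as [|p mu IH]; simpl; [destruct Req_EM_T; reflexivity|].
destruct (Req_EM_T (fst p) x) as [e|e]; simpl; rewrite IH;
  destruct (Req_EM_T y x) as [e1|e1]; trivial; destruct (Req_EM_T (fst p) y);
  try ring; congruence.
Qed.

(** Single list entries may be negative, only the total at each point is not; hence the induction
    removes all entries at one point together. *)
Lemma lin_nonneg f mu : is_distribution mu -> (forall x, 0 <= f x) -> 0 <= lin f mu.
Proof.
intros hmu hf.
remember (length mu) as n eqn:hn; assert (hle : (length mu <= n)%nat) by lia; clear hn.
revert mu hmu hle; induction n as [|n IH]; intros [|p mu] hmu hle; simpl in hle;
  try lia; try (simpl; lra).
rewrite (lin_remove_point f (fst p)).
apply Rplus_le_le_0_compat; [apply Rmult_le_pos; auto|].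
apply IH.
- intros y; rewrite mass_at_remove_point; destruct Req_EM_T; [lra|apply hmu].
- simpl; destruct Req_EM_T; [|congruence].
  unfold remove_point.
  pose proof (filter_length_le (fun p0 => if Req_EM_T (fst p0) (fst p) then false else true) mu); lia.
Qed.

Lemma lin_le f g mu : is_distribution mu -> (forall x, f x <= g x) -> lin f mu <= lin g mu.
Proof.
intros hmu h.
assert (H : 0 <= lin (fun x => g x + (-1) * f x) mu)
  by (apply lin_nonneg; trivial; intros x; specialize (h x); lra).
rewrite lin_plus, lin_scal in H; lra.
Qed.

Lemma mass_gt_lin mu a : mass_gt mu a = lin (fun x => if Rlt_dec a x then 1 else 0) mu.
Proof.
induction mu as [|p mu IH]; simpl; trivial.
rewrite IH; destruct Rlt_dec; ring.
Qed.

Lemma mass_ge_lin mu a : mass_ge mu a = lin (fun x => if Rle_dec a x then 1 else 0) mu.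
Proof.
induction mu as [|p mu IH]; simpl; trivial.
rewrite IH; destruct Rle_dec; ring.
Qed.

Definition excess (mu : sdist) (t : R) : R := lin (fun x => Rmax 0 (x - t)) mu.

Lemma excess_convex mu x y z : is_distribution mu -> x <= y <= z ->
  (z - x) * excess mu y <= (z - y) * excess mu x + (y - x) * excess mu z.
Proof.
intros hmu h; unfold excess.
rewrite <- !lin_scal, <- lin_plus.
apply lin_le; trivial; intros u.
unfold Rmax; repeat destruct Rle_dec; nra.
Qed.

Lemma excess_ge_mass_ge mu s t : is_distribution mu ->
  mass_ge mu s * Rmax 0 (s - t) <= excess mu t.
Proof.
intros hmu; rewrite mass_ge_lin, Rmult_comm, <- lin_scal.
apply lin_le; trivial; intros u.
unfold Rmax; repeat destruct Rle_dec; lra.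
Qed.

Lemma excess_le_mass_gt mu r s t : is_distribution mu -> r <= s <= t ->
  excess mu s <= excess mu t + mass_gt mu r * (t - s).
Proof.
intros hmu h; unfold excess; rewrite mass_gt_lin, Rmult_comm, <- lin_scal, <- lin_plus.
apply lin_le; trivial; intros u.
unfold Rmax; repeat destruct Rle_dec; destruct Rlt_dec; lra.
Qed.

(** Entries beyond [r] may be present and cancel. With no net mass there, the excess cannot decrease
    to the right of [r], and it vanishes beyond the last listed point. *)
Lemma excess_initial mu r t : is_distribution mu -> mass_gt mu r = 0 -> r <= t ->
  excess mu t = 0.
Proof.
intros hmu h0 ht.
assert (hr : forall u, 0 <= u -> excess mu t <= excess mu (t + u)).
{ intros u hu.
  pose proof (excess_le_mass_gt mu r t (t + u) hmu ltac:(lra)); rewrite h0 in *; lra. }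
assert (hb : exists u, 0 <= u /\ forall p, In p mu -> fst p <= t + u).
{ clear; induction mu as [|p mu [u [hu IH]]]; [exists 0; split; [lra|intros p []]|].
  exists (Rmax u (fst p - t)); pose proof (Rmax_l u (fst p - t));
  pose proof (Rmax_r u (fst p - t)); split; [lra|].
  intros p' [<-|hp]; [lra|]; specialize (IH p' hp); lra. }
destruct hb as [u [hu hb]].
assert (hz : excess mu (t + u) = 0).
{ unfold excess; rewrite (lin_ext _ (fun _ => 0 * 0)).
  - rewrite lin_scal; ring.
  - intros p hp; specialize (hb p hp); rewrite Rmax_left by lra; ring. }
specialize (hr u hu).
assert (0 <= excess mu t) by (apply lin_nonneg; trivial; intros; apply Rmax_l).
lra.
Qed.

Lemma moment_lin j mu : moment j mu = lin (fun x => x ^ j) mu.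
Proof. reflexivity. Qed.

(** For such [t] the function [Rmax 0 (x - t)] is affine on the interval of the move, and the
    moments 0 and 1 of the change vanish. *)
Lemma excess_move_outside mu v t : valid_move v -> t <= mv_a v \/ mv_a v + 1 <= t ->
  excess (mu ++ mv_delta v) t = excess mu t.
Proof.
intros [hs [h0 h1]] ht; unfold excess; rewrite lin_app.
rewrite moment_lin in h0, h1; rewrite Forall_forall in hs.
assert (hz : lin (fun x => Rmax 0 (x - t)) (mv_delta v) = 0); [|lra].
destruct ht as [ht|ht].
- rewrite (lin_ext _ (fun x => x ^ 1 + (- t) * x ^ 0)).
  + rewrite lin_plus, lin_scal, h0, h1; ring.
  + intros p hp; specialize (hs p hp); rewrite Rmax_right by lra; simpl; ring.
- rewrite (lin_ext _ (fun x => 0 * x ^ 0)).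
  + rewrite lin_scal; ring.
  + intros p hp; specialize (hs p hp); rewrite Rmax_left by lra; simpl; ring.
Qed.

(** The new excess is convex and agrees with the old one at both endpoints. *)
Lemma excess_move_chord mu v t : valid_move v -> is_distribution (mu ++ mv_delta v) ->
  mv_a v <= t <= mv_a v + 1 ->
  excess (mu ++ mv_delta v) t
    <= (mv_a v + 1 - t) * excess mu (mv_a v) + (t - mv_a v) * excess mu (mv_a v + 1).
Proof.
intros hv hmu ht.
pose proof (excess_convex _ (mv_a v) t (mv_a v + 1) hmu ht) as h.
rewrite !(excess_move_outside mu v (mv_a v)), !(excess_move_outside mu v (mv_a v + 1)) in h
  by (trivial; lra).
lra.
Qed.

(** * Evolution along a sequence of moves *)

Lemma firstn_succ {A : Type} (l : list A) i : (i < length l)%nat ->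
  exists x, In x l /\ firstn (S i) l = firstn i l ++ x :: nil.
Proof.
revert i; induction l as [|y l IH]; intros i hi; simpl in hi; [lia|].
destruct i as [|i]; [exists y; simpl; auto|].
destruct (IH i ltac:(lia)) as [x [h1 h2]].
exists x; split; [right; trivial|].
change (y :: firstn (S i) l = y :: firstn i l ++ x :: nil); rewrite h2; reflexivity.
Qed.

Lemma count_center_gt_app vs ws c :
  count_center_gt (vs ++ ws) c = (count_center_gt vs c + count_center_gt ws c)%nat.
Proof. unfold count_center_gt; rewrite filter_app, length_app; reflexivity. Qed.

(** A center exceeds [r + 1 / 2] exactly when the left endpoint exceeds [r], so the induction step
    tests the endpoint. *)
Lemma moves_ind (r m : R) mu0 vs (P : sdist -> nat -> Prop) :
  Forall valid_move vs ->
  (forall i, (i <= length vs)%nat -> is_distribution (mu_at mu0 vs i)) ->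
  (forall i, (i <= length vs)%nat -> mass_gt (mu_at mu0 vs i) r <= m) ->
  P mu0 O ->
  (forall mu v n, In v vs -> valid_move v -> is_distribution mu ->
     is_distribution (mu ++ mv_delta v) -> mass_gt mu r <= m -> P mu n ->
     P (mu ++ mv_delta v) (if Rlt_dec r (mv_a v) then S n else n)) ->
  forall i, (i <= length vs)%nat ->
    P (mu_at mu0 vs i) (count_center_gt (firstn i vs) (r + 1 / 2)).
Proof.
intros hv hd hm h0 hS i; induction i as [|i IH]; intros hi.
- unfold mu_at; simpl; rewrite app_nil_r; exact h0.
- destruct (firstn_succ vs i hi) as [v [hin hf]].
  assert (e : mu_at mu0 vs (S i) = mu_at mu0 vs i ++ mv_delta v).
  { unfold mu_at; rewrite hf, map_app, concat_app; simpl; rewrite app_nil_r, app_assoc; reflexivity. }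
  rewrite Forall_forall in hv.
  rewrite e, hf, count_center_gt_app.
  specialize (hS (mu_at mu0 vs i) v _ hin (hv v hin) (hd i ltac:(lia))
    ltac:(rewrite <- e; apply hd; lia) (hm i ltac:(lia)) (IH ltac:(lia))).
  unfold count_center_gt at 2; unfold center; simpl.
  destruct (Rlt_dec r (mv_a v)), (Rlt_dec (r + 1 / 2) (mv_a v + 1 / 2)); try lra; simpl;
    rewrite ?Nat.add_1_r, ?Nat.add_0_r; trivial.
Qed.

(** * Domination of the excess by a tail integral *)

Lemma tail_integral_set_range_above t n q i j c k : (j <= k <= n)%nat ->
  tail_integral t n (set_range i j c q) k = tail_integral t n q k.
Proof.
intros h; apply dsum_ext; [lia|intros; rewrite set_range_out by lia; reflexivity].
Qed.

Lemma tail_integral_set_range_inside t n q i j c k : (i <= k <= j)%nat -> (j <= n)%nat ->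
  tail_integral t n (set_range i j c q) k = c * (t j - t k) + tail_integral t n q j.
Proof.
intros h hj; unfold tail_integral; rewrite <- (dsum_chasles _ k j n); f_equal.
- rewrite <- dsum_len, <- dsum_scal; apply dsum_ext; [lia|intros l hl].
  rewrite set_range_in by lia; ring.
- apply dsum_ext; [lia|intros; rewrite set_range_out by lia; reflexivity].
Qed.

Lemma tail_integral_set_range_below t n q i j c k : (k <= i <= j)%nat -> (j <= n)%nat ->
  c * (t j - t i) = dsum (fun k => len t k * q k) i j ->
  tail_integral t n (set_range i j c q) k = tail_integral t n q k.
Proof.
intros h hj hc; unfold tail_integral.
rewrite <- (dsum_chasles _ k i n), <- (dsum_chasles (fun l => _ * q l) k i n); f_equal.
- apply dsum_ext; [lia|intros; rewrite set_range_out by lia; reflexivity].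
- change (tail_integral t n (set_range i j c q) i = dsum (fun k => len t k * q k) i n).
  rewrite tail_integral_set_range_inside, hc by lia; apply dsum_chasles.
Qed.

(** The last clause is the division-free form of [second_gain ^ 2 <= n * spread_gain]; quantifying
    over [u] lets increments be added move by move and covers [n = 0]. *)
Definition dominated (r m : R) (t : nat -> R) (N : nat) (mu : sdist) (n : nat) : Prop :=
  exists q, (forall k, 0 <= q k) /\
    (forall k, (k <= N)%nat -> excess mu (r + t k) <= m * tail_integral t N q k) /\
    forall u, 2 * u * second_gain t N q - u ^ 2 * INR n <= spread_gain t N q.

(** Adds [2 * u * dx - u ^ 2 <= dx ^ 2 <= ds] to the old inequality. *)
Lemma gain_step (dx ds x s n : R) :
  dx ^ 2 <= ds -> (forall u, 2 * u * x - u ^ 2 * n <= s) ->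
  forall u, 2 * u * (x + dx) - u ^ 2 * (n + 1) <= s + ds.
Proof.
intros h H u; specialize (H u); pose proof (pow2_ge_0 (dx - u)); nra.
Qed.

Lemma dominated_free r m t N mu v n :
  monotone_upto t N -> t O = 1 -> valid_move v -> mv_a v <= r ->
  dominated r m t N mu n -> dominated r m t N (mu ++ mv_delta v) n.
Proof.
intros ht ht0 hv ha [q [h1 [h2 h3]]].
exists q; split; [trivial|split; [|trivial]].
intros k hk; pose proof (monotone_upto_le t N 0 k ht ltac:(lia)).
rewrite excess_move_outside by (trivial; right; lra); auto.
Qed.

Lemma dominated_flatten r m t N mu v n i j :
  0 < m -> monotone_upto t N -> valid_move v -> is_distribution (mu ++ mv_delta v) ->
  (i <= N)%nat -> (j <= N)%nat -> r + t i = mv_a v -> r + t j = mv_a v + 1 ->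
  dominated r m t N mu n -> dominated r m t N (mu ++ mv_delta v) (S n).
Proof.
intros hm ht hv hd hi hj eti etj [q [h1 [h2 h3]]].
assert (hij : (i <= j)%nat).
{ destruct (Nat.le_gt_cases i j) as [h|h]; trivial.
  pose proof (monotone_upto_le t N j i ht ltac:(lia)); lra. }
(* As [t j - t i = 1], this is minus the slope of the chord of G. *)
set (c := dsum (fun k => len t k * q k) i j).
assert (hG : c = tail_integral t N q i - tail_integral t N q j).
{ unfold c, tail_integral; rewrite <- (dsum_chasles _ i j N); ring. }
assert (hc : 0 <= c).
{ apply (dsum_len_mul_nonneg t q i j N); trivial; lia. }
exists (set_range i j c q); split; [apply set_range_nonneg; trivial|split].
- intros k hk.
  destruct (Nat.le_gt_cases k i) as [hki|hki]; [|destruct (Nat.le_gt_cases j k) as [hjk|hjk]].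
  + pose proof (monotone_upto_le t N k i ht ltac:(lia)).
    rewrite excess_move_outside by (trivial; left; lra).
    rewrite tail_integral_set_range_below; [auto|lia|lia|].
    replace (t j - t i) with 1 by lra; apply Rmult_1_r.
  + pose proof (monotone_upto_le t N j k ht ltac:(lia)).
    rewrite excess_move_outside by (trivial; right; lra).
    rewrite tail_integral_set_range_above by lia; auto.
  + pose proof (monotone_upto_le t N i k ht ltac:(lia)).
    pose proof (monotone_upto_le t N k j ht ltac:(lia)).
    rewrite tail_integral_set_range_inside by lia.
    eapply Rle_trans; [apply excess_move_chord; trivial; lra|].
    rewrite <- etj, <- eti.
    pose proof (h2 i hi) as a1; pose proof (h2 j hj) as a2.
    apply (Rmult_le_compat_l (t j - t k)) in a1; [|lra].
    apply (Rmult_le_compat_l (t k - t i)) in a2; [|lra].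
    replace (r + t j - (r + t k)) with (t j - t k) by ring.
    replace (r + t k - (r + t i)) with (t k - t i) by ring.
    replace (m * (c * (t j - t k) + tail_integral t N q j)) with
      ((t j - t k) * (m * tail_integral t N q i) + (t k - t i) * (m * tail_integral t N q j)).
    * lra.
    * rewrite hG; replace (t i) with (t j - 1) by lra; ring.
- intros u.
  pose proof (spread_gain_flatten t N q i j ht ltac:(lia) ltac:(lra)) as hs.
  cbv zeta in hs; fold c in hs.
  pose proof (gain_step _ _ _ _ _ hs h3 u) as hg.
  rewrite S_INR; lra.
Qed.

(* Mass in [(r, r + 1]] can be replaced free of charge by mass from the left of
   [r], so the dominating excess function is kept at slope [- m] on [0, 1]. *)
Lemma dominated_refill r m t N mu v n j :
  0 < m -> monotone_upto t N -> t O = 1 -> valid_move v -> is_distribution mu ->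
  is_distribution (mu ++ mv_delta v) -> mass_gt mu r <= m ->
  r < mv_a v < r + 1 -> (j <= N)%nat -> r + t j = mv_a v + 1 ->
  dominated r m t N mu n -> dominated r m t N (mu ++ mv_delta v) (S n).
Proof.
intros hm ht ht0 hv hd0 hd hmass ha hj etj [q [h1 [h2 h3]]].
set (a := mv_a v - r).
assert (hta : t j = 1 + a) by (unfold a; lra).
set (c := 1 - a + dsum (fun k => len t k * q k) 0 j).
assert (hG : c = 1 - a + tail_integral t N q 0 - tail_integral t N q j).
{ unfold c, tail_integral; rewrite <- (dsum_chasles _ 0 j N); ring. }
assert (hc : 0 <= c).
{ pose proof (dsum_len_mul_nonneg t q 0 j N ht h1 ltac:(lia)); unfold c, a; lra. }
exists (set_range 0 j c q); split; [apply set_range_nonneg; trivial|split].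
- intros k hk.
  destruct (Nat.le_gt_cases j k) as [hjk|hjk].
  + pose proof (monotone_upto_le t N j k ht ltac:(lia)).
    rewrite excess_move_outside by (trivial; right; lra).
    rewrite tail_integral_set_range_above by lia; auto.
  + pose proof (monotone_upto_le t N 0 k ht ltac:(lia)).
    pose proof (monotone_upto_le t N k j ht ltac:(lia)).
    rewrite tail_integral_set_range_inside by lia.
    eapply Rle_trans; [apply excess_move_chord; trivial; lra|].
    rewrite <- etj.
    pose proof (h2 O ltac:(lia)) as a1; pose proof (h2 j hj) as a2.
    pose proof (excess_le_mass_gt mu r (mv_a v) (r + t O) hd0 ltac:(lra)) as a3.
    (* The slope of the excess is at least [- m] to the right of [r], which carries the domination
       from 1 back to the left endpoint. *)
    assert (a4 : excess mu (mv_a v) <= m * (tail_integral t N q 0 + (1 - a))).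
    { assert (mass_gt mu r * (r + t O - mv_a v) <= m * (r + t O - mv_a v))
        by (apply Rmult_le_compat_r; lra).
      unfold a; rewrite ht0 in *; lra. }
    apply (Rmult_le_compat_l (r + t j - (r + t k))) in a4; [|lra].
    apply (Rmult_le_compat_l (r + t k - mv_a v)) in a2; [|lra].
    eapply Rle_trans; [apply Rplus_le_compat; eassumption|].
    rewrite hG; right.
    replace (mv_a v) with (r + t j - 1) by lra; ring.
- intros u.
  pose proof (spread_gain_refill t N q j a ht hj ht0 ltac:(unfold a; lra) hta) as hs.
  cbv zeta in hs; fold c in hs.
  pose proof (gain_step _ _ _ _ _ hs h3 u) as hg.
  rewrite S_INR; lra.
Qed.

(* Exact control of the first counted move, where the spread estimate is too weak. *)
Definition few_moves (r m : R) (mu : sdist) (n : nat) : Prop :=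
  (n = O -> forall t, r + 1 <= t -> excess mu t <= 0) /\
  (n = 1%nat -> exists a, 0 <= a <= 1 /\ excess mu (r + 1) <= m * (a * (1 - a)) /\
     forall t, r + 1 + a <= t -> excess mu t <= 0).

Lemma few_moves_step r m mu v n :
  valid_move v -> is_distribution mu -> is_distribution (mu ++ mv_delta v) ->
  mass_gt mu r <= m -> few_moves r m mu n ->
  few_moves r m (mu ++ mv_delta v) (if Rlt_dec r (mv_a v) then S n else n).
Proof.
intros hv hd0 hd hm [h0 h1].
destruct (Rlt_dec r (mv_a v)) as [ha|ha].
- split; [discriminate|intros hn].
  assert (n = O) as hn0 by lia; specialize (h0 hn0).
  destruct (Rle_lt_dec (r + 1) (mv_a v)) as [ha1|ha1].
  (* The move lies where the excess is zero and creates none. *)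
  + exists 0; split; [lra|].
    assert (hz : forall t, r + 1 <= t -> excess (mu ++ mv_delta v) t <= 0).
    { intros t ht.
      destruct (Rle_lt_dec t (mv_a v)); [|destruct (Rle_lt_dec (mv_a v + 1) t)];
        try (rewrite excess_move_outside by (trivial; lra); auto).
      eapply Rle_trans; [apply excess_move_chord; trivial; lra|].
      pose proof (h0 (mv_a v) ha1); pose proof (h0 (mv_a v + 1) ltac:(lra)); nra. }
    split; [specialize (hz (r + 1) ltac:(lra)); lra|intros t ht; apply hz; lra].
  (* The chord falls from at most [m * (1 - a)] at [a] to 0 at [1 + a], hence is at most
     [m * (a * (1 - a))] at 1. *)
  + exists (mv_a v - r); split; [lra|split].
    * eapply Rle_trans; [apply excess_move_chord; trivial; lra|].
      pose proof (excess_le_mass_gt mu r (mv_a v) (r + 1) hd0 ltac:(lra)).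
      pose proof (h0 (r + 1) ltac:(lra)); pose proof (h0 (mv_a v + 1) ltac:(lra)).
      assert (e1 : excess mu (mv_a v) <= m * (r + 1 - mv_a v)) by nra.
      apply (Rmult_le_compat_l (mv_a v + 1 - (r + 1))) in e1; [|lra].
      nra.
    * intros t ht; rewrite excess_move_outside by (trivial; lra); apply h0; lra.
- split; intros hn.
  + intros t ht; rewrite excess_move_outside by (trivial; lra); auto.
  + destruct (h1 hn) as [a [g1 [g2 g3]]]; exists a; split; [trivial|split].
    * rewrite excess_move_outside by (trivial; lra); trivial.
    * intros t ht; rewrite excess_move_outside by (trivial; lra); auto.
Qed.

(** * Counting moves *)

Lemma move_count_bound (n : nat) (X x s : R) :
  0 <= X -> X - 1 / 4 <= x ->
  (forall u, 2 * u * x - u ^ 2 * INR n <= s) ->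
  (forall th, 0 < th <= 2 -> s <= th / 2 * x + (1 - th / 2) ^ 3 / (6 * th)) ->
  n <> O -> (n = 1%nat -> X <= 65 / 100) -> 3 * X ^ 3 <= INR n ^ 2.
Proof.
intros hX hx hlow hup hn0 hn1.
assert (mono : forall Y, X <= Y -> 3 * X ^ 3 <= 3 * Y ^ 3).
{ intros Y hY; apply Rmult_le_compat_l; [lra|apply pow_incr; lra]. }
destruct (Nat.eq_dec n 1) as [->|hn2].
{ pose proof (mono _ (hn1 eq_refl)); simpl; lra. }
(* The thresholds 11/10 and 144/100 lie just below the solutions of [3 * X ^ 3 = 4] and
   [3 * X ^ 3 = 9], so [n >= 2] and [n >= 3] suffice up to them. *)
destruct (Rle_lt_dec X (11 / 10)) as [hX1|hX1].
{ pose proof (mono _ hX1).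
  assert (2 <= INR n) by (change 2 with (INR 2); apply le_INR; lia); nra. }
assert (hn3 : 3 <= INR n).
{ destruct (Nat.eq_dec n 2) as [->|].
  - (* near-optimal [u] and [th] for [X = 11 / 10] *)
    specialize (hlow (418 / 1000)); specialize (hup (55 / 100) ltac:(lra)); simpl in *; lra.
  - replace 3 with (INR 3) by (simpl; ring); apply le_INR; lia. }
destruct (Rle_lt_dec X (144 / 100)) as [hX2|hX2].
{ pose proof (mono _ hX2); nra. }
set (sg := sqrt (X / 3)).
assert (hsg : sg * sg = X / 3) by (apply sqrt_sqrt; lra).
assert (hsg0 : 0 <= sg) by apply sqrt_pos.
assert (hsg1 : 2 / 3 <= sg) by nra.
(* 1/sqrt (3 X) is the optimal [th] for the bound sqrt (X / 3), and the optimal [u] at the extremal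
   count [9 * sg ^ 3] = sqrt 3 X^(3/2). The initial values 1/4 do no harm once [w <= 1 / 2]. *)
set (w := / (3 * sg)).
assert (hw : w * (3 * sg) = 1) by (unfold w; field; lra).
assert (hw1 : 0 < w <= 1 / 2) by (split; nra).
specialize (hlow w); specialize (hup w ltac:(lra)).
replace ((1 - w / 2) ^ 3 / (6 * w)) with (/ (6 * w) - 1 / 4 + w / 8 - w ^ 2 / 48) in hup
  by (field; lra).
replace (/ (6 * w)) with (sg / 2) in hup by (unfold w; field; lra).
assert (main : 9 * sg ^ 3 <= INR n).
{ assert (e1 : w ^ 2 * (9 * sg ^ 3) = sg).
  { replace (w ^ 2 * (9 * sg ^ 3)) with ((w * (3 * sg)) ^ 2 * sg) by ring.
    rewrite hw; ring. }
  assert (e2 : w * X = sg).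
  { replace X with (3 * (sg * sg)) by lra.
    replace (w * (3 * (sg * sg))) with (w * (3 * sg) * sg) by ring; rewrite hw; ring. }
  apply Rmult_le_reg_l with (w ^ 2); [nra|].
  rewrite e1.
  assert (w * (X - 1 / 4) <= w * x) by (apply Rmult_le_compat_l; lra).
  pose proof (pow2_ge_0 w); lra. }
assert (0 <= sg ^ 3) by (apply pow_le; lra).
replace (3 * X ^ 3) with ((9 * sg ^ 3) ^ 2).
- apply pow_incr; lra.
- replace X with (3 * (sg * sg)) by lra; ring.
Qed.

Theorem mainTheorem14 (r m d p : R) (mu0 : sdist) (vs : list move) :
  0 < m -> 1 < d -> 0 < p < 1 ->
  Forall valid_move vs ->
  (* mu0 is a distribution and every move applies (each mu_i is a distribution) *)
  (forall i, (i <= length vs)%nat -> is_distribution (mu_at mu0 vs i)) ->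
  mass_gt mu0 r = 0 ->
  (* mu_max{x > r} <= m *)
  (forall i, (i <= length vs)%nat -> mass_gt (mu_at mu0 vs i) r <= m) ->
  (* mu_max{x >= r + d} >= p m *)
  (exists i, (i <= length vs)%nat /\ p * m <= mass_ge (mu_at mu0 vs i) (r + d)) ->
  sqrt 3 * Rpower p (3 / 2) * (d - 1 / 2) ^ 3
    <= INR (count_center_gt vs (r + 1 / 2)).
Proof.
intros hm hd hp hv hdist h0 hmass [i [hi hpm]].
assert (hd0 : is_distribution mu0).
{ specialize (hdist O ltac:(lia)); unfold mu_at in hdist; simpl in hdist.
  rewrite app_nil_r in hdist; exact hdist. }
destruct (grid_exists 1 (map (fun v => mv_a v - r) vs ++ map (fun v => mv_a v - r + 1) vs))
  as [t [N [ht [ht0 hgrid]]]].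
assert (hdom : dominated r m t N (mu_at mu0 vs i) (count_center_gt (firstn i vs) (r + 1 / 2))).
{ apply moves_ind with m; trivial.
  - exists (fun _ => 0); split; [intros; lra|split].
    + intros k hk; pose proof (monotone_upto_le t N 0 k ht ltac:(lia)).
      rewrite (excess_initial mu0 r) by (trivial; lra).
      apply Rmult_le_pos; [lra|apply tail_integral_nonneg; trivial; intros; lra].
    + intros u; unfold second_gain, spread_gain.
      rewrite (dsum_eq0 (fun k => _ * 0)), (dsum_eq0 (fun k => _ * (0 - _)))
        by (intros; field).
      simpl; lra.
  - intros mu v n hin hvv hd1 hd2 hm1 hP.
    destruct (Rlt_dec r (mv_a v)) as [ha|ha]; [|apply dominated_free; trivial; lra].
    destruct (hgrid (mv_a v - r + 1)) as [j [hj etj]].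
    { apply in_or_app; right; exact (in_map (fun v => mv_a v - r + 1) vs v hin). }
    { lra. }
    destruct (Rlt_dec (mv_a v) (r + 1)) as [ha1|ha1].
    + apply dominated_refill with j; trivial; lra.
    + destruct (hgrid (mv_a v - r)) as [k [hk etk]].
      { apply in_or_app; left; exact (in_map (fun v => mv_a v - r) vs v hin). }
      { lra. }
      apply dominated_flatten with k j; trivial; lra. }
assert (hfew : few_moves r m (mu_at mu0 vs i) (count_center_gt (firstn i vs) (r + 1 / 2))).
{ apply moves_ind with m; trivial.
  - split; [|discriminate].
    intros _ s hs; rewrite (excess_initial mu0 r) by (trivial; lra); lra.
  - intros mu v n _; apply few_moves_step. }
assert (hcount : (count_center_gt (firstn i vs) (r + 1 / 2) <= count_center_gt vs (r + 1 / 2))%nat).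
{ rewrite <- (firstn_skipn i vs) at 2; rewrite count_center_gt_app; lia. }
set (n := count_center_gt (firstn i vs) (r + 1 / 2)) in *.
set (mu := mu_at mu0 vs i) in *.
assert (hex : forall s, p * m * Rmax 0 (r + d - s) <= excess mu s).
{ intros s; eapply Rle_trans; [|apply (excess_ge_mass_ge mu (r + d)); apply hdist; trivial].
  apply Rmult_le_compat_r; [apply Rmax_l|trivial]. }
assert (hex' : forall s, p * m * (r + d - s) <= excess mu s).
{ intros s; eapply Rle_trans; [|apply hex].
  apply Rmult_le_compat_l; [nra|apply Rmax_r]. }
assert (hpm0 : 0 < p * m) by nra.
set (X := p * (d - 1 / 2) ^ 2).
assert (hX : 3 * X ^ 3 <= INR n ^ 2).
{ destruct hdom as [q [q1 [q2 q3]]]; destruct hfew as [f0 f1].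
  assert (hG : forall k, (k <= N)%nat -> p * Rmax 0 (d - t k) <= tail_integral t N q k).
  { intros k hk; apply Rmult_le_reg_l with m; trivial.
    eapply Rle_trans; [|apply q2; trivial].
    eapply Rle_trans; [|apply hex].
    replace (r + d - (r + t k)) with (d - t k) by ring; lra. }
  (* G vanishes at the last grid point, whereas the excess is positive before [r + d]. *)
  assert (hdN : d <= t N).
  { pose proof (q2 N ltac:(lia)) as e; unfold tail_integral in e; rewrite dsum_refl in e.
    pose proof (hex' (r + t N)); nra. }
  pose proof (second_gain_ge t N q p d ht ht0 ltac:(lra) ltac:(lra) hG).
  apply move_count_bound with (second_gain t N q) (spread_gain t N q); trivial.
  - unfold X; apply Rmult_le_pos; [lra|apply pow2_ge_0].
  - unfold X; nra.
  - intros th hth; apply spread_gain_le; trivial.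
  - intros hn; pose proof (f0 hn (r + 1) ltac:(lra)); pose proof (hex' (r + 1)); nra.
  - intros hn; destruct (f1 hn) as [a [g1 [g2 g3]]].
    pose proof (g3 (r + 1 + a) ltac:(lra)); pose proof (hex' (r + 1 + a)).
    assert (hda : d - 1 <= a) by nra.
    assert (hpd : p * (d - 1) <= a * (1 - a)).
    { apply Rmult_le_reg_l with m; trivial; pose proof (hex' (r + 1)); lra. }
    (* [X] is [p * (d - 1) ^ 2 + p * (d - 1) + p / 4], at most [a - a ^ 3 + 1 / 4]; 58/100 is close
       to the maximiser 1/sqrt 3, which yields the bound 65/100. *)
    assert (hcub : a - a ^ 3 <= 4 / 10).
    { assert (0 <= (a - 58 / 100) ^ 2 * (a + 116 / 100))
        by (apply Rmult_le_pos; [apply pow2_ge_0|lra]); lra. }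
    assert (p * (d - 1) * (d - 1) <= a * (1 - a) * a) by (apply Rmult_le_compat; nra).
    unfold X; nra. }
apply Rle_trans with (INR n); [|apply le_INR; trivial].
apply Rsqr_incr_0_var; [|apply pos_INR].
unfold Rsqr.
replace (_ * _) with (sqrt 3 * sqrt 3 * (Rpower p (3 / 2) * Rpower p (3 / 2)) * (d - 1 / 2) ^ 6)
  by ring.
rewrite sqrt_sqrt, <- Rpower_plus by lra.
replace (3 / 2 + 3 / 2) with (INR 3) by (simpl; field).
rewrite Rpower_pow by lra.
replace (3 * p ^ 3 * (d - 1 / 2) ^ 6) with (3 * X ^ 3) by (unfold X; ring).
lra.
Qed.
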